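(* Let $\mathbb{K}$ be a field with at most $3$ elements. Then, for every integer $n\geq 1$, every matrix of $\mathrm{M}_n(\mathbb{K})$ is a sum of three idempotent matrices of $\mathrm{M}_n(\mathbb{K})$.
   Context: An idempotent matrix is a matrix $Q\in \mathrm{M}_n(\mathbb{K})$ with $Q^2=Q$ (the zero matrix and the identity matrix are idempotents). *)

(* Defs.v *)
From mathcomp Require Import all_boot all_order all_algebra.

Set Implicit Arguments.
Unset Strict Implicit.
Unset Printing Implicit Defensive.

Import GRing.Theory.
Local Open Scope ring_scope.

Definition idempotent_mx (K : fieldType) (n : nat) (Q : 'M[K]_n) : Prop :=
  Q *m Q = Q.

(* Main.v *)
(* Call M odd for a splitting V = V0 + V1 if it exchanges V0 and V1. With D the
   projection onto V0, 1 + M = D (1 + M) + (1 - D) (1 + M) is then a sum of two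
   idempotents; hence A is a sum of three idempotents as soon as the even part
   of A - 1 is idempotent.

   Splitting off stable complements reduces the problem to a matrix A with a
   cyclic vector v. In a Newton basis v, v (A - d_0), v (A - d_0) (A - d_1), ...
   it becomes a Hessenberg matrix: before the last row, row i is d_i on the
   diagonal, 1 just after it and 0 elsewhere, while the last diagonal entry is
   forced by the trace. If the trace is n, take d = 1: the even rows and the odd
   rows before the last one, and the last row, give the three idempotents. If it
   is n + 1 or n + 2, take d = 1 except possibly for a 2 in the last-but-one
   position, so that the last diagonal entry is 2; splitting the basis by
   parity, the even part of A - 1 is idempotent (for n = 1 and trace 3, use
   A = 1 + 1 + 1). Over a field with at most 3 elements, 0, 1 and 2 exhaust
   all values of tr A - n. *)
Require Import Defs.
From mathcomp Require Import all_boot all_order all_algebra.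

Import GRing.Theory.
Local Open Scope ring_scope.

Set Implicit Arguments.
Unset Strict Implicit.
Unset Printing Implicit Defensive.

(** * Similarity and stable splittings *)

Definition sum3_idempotents (K : fieldType) n (A : 'M[K]_n) : Prop :=
  exists P Q R : 'M[K]_n,
    [/\ idempotent_mx P, idempotent_mx Q, idempotent_mx R & A = P + Q + R].

Definition stably_split (K : fieldType) n (A : 'M[K]_n) : Prop :=
  exists U W : 'M[K]_n,
    [/\ stablemx U A, stablemx W A, (U :&: W = 0)%MS &
        [/\ \rank U + \rank W = n, 0 < \rank U & 0 < \rank W]%N].

(** Size at most n + 1 means degree at most n: the vectors v, v A, ..., v A^n form a basis. *)
Definition cyclic_vector (K : fieldType) n (A : 'M[K]_n.+1) (v : 'rV[K]_n.+1) : Prop :=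
  forall p : {poly K}, (size p <= n.+1)%N -> v *m horner_mx A p = 0 -> p = 0.

Section SumOfThree.
Variable K : fieldType.

(** Two sizes are allowed because a stable splitting yields a block matrix of size
    [\rank U + \rank W], equal to n only by a proof. *)
Lemma sum3_conj m n (T : 'M[K]_(m, n)) (T' : 'M_(n, m)) (A : 'M_n) (B : 'M_m) :
  T *m T' = 1%:M -> T' *m T = 1%:M -> T *m A = B *m T ->
  sum3_idempotents B -> sum3_idempotents A.
Proof.
move=> TT' T'T TA [P [Q [R [iP iQ iR defB]]]].
have conj_idem (X : 'M_m) : idempotent_mx X -> idempotent_mx (T' *m X *m T).
  move=> iX; rewrite /idempotent_mx !mulmxA -(mulmxA _ T T') TT' mulmx1.
  by rewrite -(mulmxA T' X X) iX.
exists (T' *m P *m T), (T' *m Q *m T), (T' *m R *m T); split; try exact: conj_idem.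
by rewrite -!mulmxDl -!mulmxDr -defB -mulmxA -TA mulmxA T'T mul1mx.
Qed.

Lemma sum3_block_diag m n (A : 'M[K]_m) (B : 'M[K]_n) :
  sum3_idempotents A -> sum3_idempotents B ->
  sum3_idempotents (block_mx A 0 0 B).
Proof.
move=> [P1 [Q1 [R1 [iP1 iQ1 iR1 ->]]]] [P2 [Q2 [R2 [iP2 iQ2 iR2 ->]]]].
have block_idem (X : 'M[K]_m) (Y : 'M[K]_n) :
  idempotent_mx X -> idempotent_mx Y -> idempotent_mx (block_mx X 0 0 Y).
  move=> iX iY; rewrite /idempotent_mx mulmx_block !mulmx0 !mul0mx.
  by rewrite !addr0 !add0r iX iY.
exists (block_mx P1 0 0 P2), (block_mx Q1 0 0 Q2), (block_mx R1 0 0 R2).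
by split; rewrite ?add_block_mx ?addr0 //; exact: block_idem.
Qed.

Lemma sum3_split n (A : 'M[K]_n) :
  (forall m (B : 'M[K]_m), (m < n)%N -> sum3_idempotents B) ->
  stably_split A -> sum3_idempotents A.
Proof.
move=> IH [U [W [sU sW UW0 [rUW U_gt0 W_gt0]]]].
have ltUn : (\rank U < n)%N by rewrite -[ltnRHS]rUW -addn1 leq_add2l.
have ltWn : (\rank W < n)%N by rewrite -[ltnRHS]rUW -add1n leq_add2r.
have /submxP[B defB] : stablemx (row_base U) A by rewrite stablemx_row_base.
have /submxP[C defC] : stablemx (row_base W) A by rewrite stablemx_row_base.
pose T := col_mx (row_base U) (row_base W).
have rT : \rank T = n.
  rewrite -addsmxE (adds_eqmx (eq_row_base U) (eq_row_base W)).
  by rewrite mxrank_disjoint_sum.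
apply: (@sum3_conj _ _ T (pinvmx T) A (block_mx B 0 0 C)).
- by apply: mulmxVp; rewrite /row_free rT rUW.
- by apply: mulVpmx; rewrite /row_full rT.
- by rewrite mul_col_mx defB defC mul_block_col !mul0mx addr0 add0r.
- by apply: sum3_block_diag; apply: IH.
Qed.

(** * Criteria from partitions of the basis *)

Lemma sum3_partition n (A D1 D2 D3 : 'M[K]_n) :
  D1 + D2 + D3 = 1%:M ->
  D1 *m A *m D1 = D1 -> D2 *m A *m D2 = D2 -> D3 *m A *m D3 = D3 ->
  sum3_idempotents A.
Proof.
(* D A D = D gives (D A)^2 = D A. *)
move=> D_1 c1 c2 c3; exists (D1 *m A), (D2 *m A), (D3 *m A).
by split; rewrite /idempotent_mx ?mulmxA ?c1 ?c2 ?c3 // -!mulmxDl D_1 mul1mx.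
Qed.

Lemma sum3_even_part n (M D : 'M[K]_n) :
  idempotent_mx D ->
  idempotent_mx (D *m M *m D + (1%:M - D) *m M *m (1%:M - D)) ->
  sum3_idempotents (1%:M + M).
Proof.
rewrite /idempotent_mx; set E := 1%:M - D => iD iR.
have DE : D *m E = 0 by rewrite mulmxBr mulmx1 iD subrr.
have ED : E *m D = 0 by rewrite mulmxBl mul1mx iD subrr.
have iE : E *m E = E by rewrite {1}/E mulmxBl mul1mx DE subr0.
have D_E : D + E = 1%:M by rewrite addrC subrK.
clearbody E.
have defM : M = D *m M *m D + D *m M *m E + (E *m M *m D + E *m M *m E).
  by rewrite -!mulmxDr D_E !mulmx1 -mulmxDl D_E mul1mx.
(* Since E D = 0, right multiplication by D + D M E fixes D and kills D M E; the second matrix is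
   symmetric to the first. *)
exists (D + D *m M *m E), (E + E *m M *m D), (D *m M *m D + E *m M *m E); split=> //.
- have DMED : D *m M *m E *m D = 0 by rewrite -mulmxA ED mulmx0.
  by rewrite /idempotent_mx mulmxDl !mulmxDr !mulmxA iD DMED !mul0mx !addr0.
- have EMDE : E *m M *m D *m E = 0 by rewrite -mulmxA DE mulmx0.
  by rewrite /idempotent_mx mulmxDl !mulmxDr !mulmxA iE EMDE !mul0mx !addr0.
rewrite {1}defM -{1}D_E [D *m M *m D + D *m M *m E]addrC.
by rewrite [X in _ + X = _]addrACA [LHS]addrA [X in X + _ = _]addrACA.
Qed.

Lemma diag_corner_mxE n (d e : 'rV[K]_n) (A : 'M_n) i j :
  (diag_mx d *m A *m diag_mx e) i j = d 0 i * A i j * e 0 j.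
Proof. by rewrite mul_mx_diag mxE mul_diag_mx mxE. Qed.

Lemma sum3_three_colors n (A : 'M[K]_n) (col : 'I_n -> nat) :
  (forall i, col i < 3)%N ->
  (forall i j, col i = col j -> A i j = (i == j)%:R) -> sum3_idempotents A.
Proof.
move=> lt_col monoA.
pose D k : 'M[K]_n := diag_mx (\row_i (col i == k)%:R).
have corner k : D k *m A *m D k = D k.
  apply/matrixP=> i j; rewrite diag_corner_mxE !mxE.
  have [ci | _] := eqVneq (col i) k; last by rewrite !mul0r mul0rn.
  have [cj | nej] := eqVneq (col j) k; first by rewrite monoA ?ci ?cj // mulr1 mul1r.
  have [ij | _] := eqVneq i j; last by rewrite mulr0.
  by rewrite -ij ci eqxx in nej.
apply: (@sum3_partition _ A (D 0%N) (D 1%N) (D 2%N)); try exact: corner.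
apply/matrixP=> i j; rewrite !mxE -!mulrnDl; congr (_ *+ _).
by case: (col i) (lt_col i) => [|[|[|]]] //= _; rewrite ?addr0 ?add0r.
Qed.

Lemma sum3_two_colors n (M : 'M[K]_n) (col : 'I_n -> bool) :
  idempotent_mx (\matrix_(i, j) (if col i == col j then M i j else 0)) ->
  sum3_idempotents (1%:M + M).
Proof.
move=> iR; pose d b : 'rV[K]_n := \row_i (col i == b)%:R.
have compl : 1%:M - diag_mx (d true) = diag_mx (d false).
  apply/matrixP=> i j; rewrite !mxE -mulrnBl; congr (_ *+ _).
  by case: (col i); rewrite ?subrr ?subr0.
apply: (@sum3_even_part _ M (diag_mx (d true))).
  apply/matrixP=> i j; rewrite mul_diag_mx !mxE.
  by case: (col i); rewrite ?mul1r ?mul0r ?mul0rn.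
rewrite compl; congr idempotent_mx: iR; apply/matrixP=> i j.
rewrite [RHS]mxE !diag_corner_mxE !mxE.
by case: (col i); case: (col j); rewrite ?(mul1r, mul0r, mulr1, mulr0, addr0, add0r).
Qed.

(** * Hessenberg matrices *)

Lemma ord_maxP n (k : 'I_n.+1) : (n <= k)%N -> k = ord_max.
Proof. by move=> lek; apply/val_inj/eqP; rewrite eqn_leq lek -ltnS ltn_ord. Qed.

Lemma sum3_hessenberg_trace0 n (C : 'M[K]_n.+1) :
  (forall i j : 'I_n.+1, (i < n)%N ->
     C i j = (i == j)%:R + (i.+1 == j :> nat)%:R) ->
  C ord_max ord_max = 1 -> sum3_idempotents C.
Proof.
move=> defC Cnn.
(* The last row is arbitrary off the diagonal, so its index gets a color of its own; elsewhere the
   superdiagonal joins opposite parities. *)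
pose col (i : 'I_n.+1) := if (i < n)%N then nat_of_bool (odd i) else 2%N.
apply: (@sum3_three_colors _ C col) => [i | i j]; rewrite /col.
  by case: ifP => // _; case: odd.
have [ltin | lein] := ltnP i n; have [ltjn | lejn] := ltnP j n.
- move=> oij; rewrite defC //; have [ij | _] := eqVneq i.+1 (j : nat); last by rewrite addr0.
  by move: oij; rewrite -ij /=; case: odd.
- by case: odd.
- by case: odd.
by rewrite (ord_maxP lein) (ord_maxP lejn) eqxx.
Qed.

(** Above its last row, the even part R of C - 1 vanishes except for a 1 in the last-but-one
    diagonal position when [b] holds. Its last row r has a 1 on the diagonal and, by parity, a 0
    just before it, so r R = r. *)
Lemma sum3_hessenberg_trace12 n (C : 'M[K]_n.+1) (b : bool) :
  (forall i j : 'I_n.+1, (i < n)%N ->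
     C i j = (i == j)%:R + (b && (i.+1 == n) && (i == j))%:R
             + (i.+1 == j :> nat)%:R) ->
  C ord_max ord_max = 1 + 1 -> sum3_idempotents C.
Proof.
move=> defC Cnn.
have -> : C = 1%:M + (C - 1%:M) by rewrite addrC subrK.
apply: (@sum3_two_colors _ _ (fun i : 'I_n.+1 => odd i)).
set R := \matrix_(i, j) _.
have RltE (i j : 'I_n.+1) : (i < n)%N -> R i j = (b && (i.+1 == n) && (i == j))%:R.
  move=> ltin; rewrite !mxE defC //.
  have [ij | neij] := eqVneq i.+1 (j : nat).
    have -> : (odd i == odd j) = false by rewrite -ij /=; case: odd.
    case: (i =P j) => [eij|_]; last by rewrite andbF.
    by move: ij; rewrite -eij => /eqP; rewrite eqn_leq ltnn.
  rewrite addr0 addrAC subrr add0r; case: ifP => // /negbT nodd.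
  by have [eij | _] := eqVneq i j; rewrite ?andbF //; rewrite eij eqxx in nodd.
have Rnn : R ord_max ord_max = 1 by rewrite !mxE !eqxx Cnn addrK.
have Rn_pred (j : 'I_n.+1) : j.+1 = n -> R ord_max j = 0.
  by move=> jn; rewrite mxE /= -[X in odd X == _]jn /=; case: odd.
apply/matrixP=> i k; rewrite mxE.
have [ltin | /ord_maxP->] := ltnP i n.
  under eq_bigr do rewrite RltE //.
  rewrite (bigD1 i) //= big1 => [|j neji]; last first.
    by rewrite [i == j]eq_sym (negPf neji) andbF mul0r.
  by rewrite eqxx andbT RltE //; case: (b && _); rewrite ?mul1r ?mul0r addr0.
rewrite (bigD1 ord_max) //= Rnn mul1r big1 ?addr0 // => j nej.
have ltjn : (j < n)%N by rewrite ltnNge; apply: contra nej => /ord_maxP->.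
rewrite (RltE j) //; have [/Rn_pred-> | _] := eqVneq j.+1 n; first by rewrite mul0r.
by rewrite andbF mulr0.
Qed.

(** * Newton bases for a cyclic vector *)

Lemma newton_free (N : nat -> {poly K}) (a : nat -> K) m :
  (forall i, N i \is monic /\ size (N i) = i.+1) ->
  \sum_(i < m) a i *: N i = 0 -> forall i, (i < m)%N -> a i = 0.
Proof.
move=> monN; elim: m => [|m IHm] //; rewrite big_ord_recr /= => sum0.
have a_m : a m = 0.
  have [/monicP lcN szN] := monN m.
  move/(congr1 (fun p : {poly K} => p`_m)): sum0; rewrite coefD coefZ coef0 coef_sum.
  rewrite big1 ?add0r => [|i _]; last by rewrite coefZ nth_default ?mulr0 // (monN i).2.
  by move: lcN; rewrite lead_coefE szN /= => ->; rewrite mulr1.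
move: sum0; rewrite a_m scale0r addr0 => /IHm a0 i.
by rewrite ltnS leq_eqVlt => /predU1P[-> | /a0].
Qed.

Lemma cyclic_hessenberg n (A : 'M[K]_n.+1) v (d : nat -> K) :
  cyclic_vector A v ->
  exists T C : 'M[K]_n.+1, [/\ T \in unitmx, T *m A = C *m T &
    forall i j : 'I_n.+1, (i < n)%N ->
      C i j = d i * (i == j)%:R + (i.+1 == j :> nat)%:R].
Proof.
move=> cycv; pose N i := \prod_(c <- mkseq d i) ('X - c%:P).
have monN i : N i \is monic /\ size (N i) = i.+1.
  by rewrite monic_prod_XsubC size_prod_XsubC size_mkseq.
have N_S i : N i.+1 = N i * ('X - (d i)%:P) by rewrite /N mkseqS big_rcons.
pose T : 'M[K]_n.+1 := \matrix_i (v *m horner_mx A (N i)).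
have T_free : row_free T.
  apply: inj_row_free => a aT0; apply/rowP=> i; rewrite mxE.
  rewrite -[i in a 0 i]inord_val.
  apply: (newton_free (a := fun k => a 0 (inord k)) (m := n.+1) monN) => //.
  apply: cycv.
    apply: (leq_trans (size_sum _ _ _)); apply/bigmax_leqP=> j _.
    by rewrite (leq_trans (size_scale_leq _ _)) // (monN j).2.
  rewrite -[RHS]aT0 raddf_sum /= mulmx_sumr mulmx_sum_row; apply: eq_bigr => j _.
  by rewrite rowK inord_val linearZ /= -scalemxAr.
have uT : T \in unitmx by rewrite -row_free_unit.
exists T, (T *m A *m invmx T); split=> [//||i j ltin]; first by rewrite mulmxKV.
(* This is N_i X = d_i N_i + N_{i+1}, evaluated at A and applied to v. *)
have rowS : row i T *m A = d i *: row i T + row (inord i.+1) T.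
  rewrite !rowK inordK // N_S rmorphM /= rmorphB /= horner_mx_X horner_mx_C.
  by rewrite -mulmxE mulmxBr mulmxBr mulmxA mul_mx_scalar scalemxAr addrC subrK.
have -> : (T *m A *m invmx T) i j = (row i (T *m A *m invmx T)) 0 j by rewrite [RHS]mxE.
rewrite !row_mul rowS mulmxDl -scalemxAl -!row_mul mulmxV // !mxE.
by rewrite -[inord _ == j]val_eqE /= inordK.
Qed.

Lemma sum3_cyclic n (A : 'M[K]_n.+1) v : cyclic_vector A v ->
  [\/ \tr A = n.+1%:R, \tr A = n.+1%:R + 1 | \tr A = n.+1%:R + 1 + 1] ->
  sum3_idempotents A.
Proof.
move=> cycv trA.
have hess (d : nat -> K) : exists2 C : 'M[K]_n.+1,
    [/\ sum3_idempotents C -> sum3_idempotents A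
       & C ord_max ord_max = \tr A - \sum_(i < n) d i]
  & forall i j : 'I_n.+1, (i < n)%N ->
      C i j = d i * (i == j)%:R + (i.+1 == j :> nat)%:R.
  have [T [C [uT TA defC]]] := cyclic_hessenberg d cycv.
  exists C => //; split; first exact: (sum3_conj (mulmxV uT) (mulVmx uT) TA).
  have -> : \tr A = \tr C by rewrite -[C](mulmxK uT) -TA mxtrace_mulC mulKmx.
  rewrite /mxtrace big_ord_recr /= (eq_bigr (fun i : 'I_n => d i)) => [|i _].
    by rewrite [RHS]addrC addKr.
  by rewrite defC //= eqxx mulr1 gtn_eqF // addr0.
(* The correction for [b] sits at index n - 1, which exists only for positive n. *)
have last_diag (b : bool) : b ==> (0 < n)%N ->
    \sum_(i < n) (1 + (b && (i.+1 == n))%:R) = n%:R + b%:R :> K.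
  case: n {A v cycv trA hess} => [|n]; first by case: b => // _; rewrite big_ord0 addr0.
  move=> _; rewrite big_split /= sumr_const card_ord; congr (_ + _).
  rewrite big_ord_recr /= eqxx andbT big1 ?add0r // => i _.
  by rewrite eqSS ltn_eqF ?andbF.
have trace12 (b : bool) : b ==> (0 < n)%N ->
    \tr A = n.+1%:R + 1 + b%:R -> sum3_idempotents A.
  move=> b_n trAb.
  have [C [toA Cnn] defC] := hess (fun i => 1 + (b && (i.+1 == n))%:R).
  apply: toA; apply: (@sum3_hessenberg_trace12 _ C b) => [i j ltin|].
    by rewrite defC // mulrDl mul1r -natrM mulnb.
  by rewrite Cnn last_diag // trAb opprD addrACA subrr addr0 -natr1
    -[_ + 1 + 1]addrA addrAC subrr add0r.
case: trA => trA.
- have [C [toA Cnn] defC] := hess (fun _ => 1).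
  apply: toA; apply: sum3_hessenberg_trace0 => [i j ltin|]; first by rewrite defC // mul1r.
  by rewrite Cnn trA sumr_const card_ord -natr1 addrAC subrr add0r.
- by apply: (trace12 false) => //; rewrite addr0.
case: (posnP n) => [n0 | n_gt0]; last exact: (trace12 true).
subst n; exists 1%:M, 1%:M, 1%:M; split; rewrite /idempotent_mx ?mulmx1 //.
by apply/matrixP=> i j; rewrite !ord1 !mxE -[LHS]trace_mx11 trA.
Qed.

(** * Stable complements and cyclic vectors *)

Lemma horner_mx_modp n (A : 'M[K]_n.+1) mu p :
  horner_mx A mu = 0 -> horner_mx A (p %% mu) = horner_mx A p.
Proof. by move=> mu0; rewrite [in RHS](divp_eq p mu) rmorphD rmorphM /= mu0 mulr0 add0r. Qed.

(** The orbit of v spans a space of dimension deg mu, the largest that a cyclic subspace can have;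
    this maximality makes it a stable direct summand. *)
Lemma split_or_cyclic n (A : 'M[K]_n.+1) (v : 'rV_n.+1) (mu : {poly K}) :
  mu != 0 -> horner_mx A mu = 0 ->
  (forall p : {poly K}, (size p < size mu)%N -> v *m horner_mx A p = 0 -> p = 0) ->
  stably_split A \/ cyclic_vector A v.
Proof.
move=> mu_neq0 muA mu_min.
(* A nonzero constant cannot annihilate a matrix of positive size, so mu has degree m + 1 for some
   m. *)
have [m size_mu] : exists m, size mu = m.+2.
  case E: (size mu) => [|[|m]]; last by exists m.
    by move: mu_neq0; rewrite -size_poly_eq0 E.
  have := mu_min 1; rewrite E size_poly1.
  move: muA; have /eqP/size_poly1P[c c_neq0 ->] := E.
  rewrite horner_mx_C => cA; move/matrixP/(_ 0 0)/eqP: cA.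
  by rewrite !mxE eqxx (negPf c_neq0).
have size_mod p : (size (p %% mu)%R <= m.+1)%N by rewrite -ltnS -size_mu ltn_modp.
pose T : 'M_(m.+1, n.+1) := lin1_mx (mulmx v \o horner_mx A \o rVpoly).
have TE a : a *m T = v *m horner_mx A (rVpoly a) by rewrite mul_rV_lin1.
have subT p : (v *m horner_mx A p <= T)%MS.
  by apply/submxP; exists (poly_rV (p %% mu)); rewrite TE poly_rV_K // horner_mx_modp.
have T_free : row_free T.
  apply: inj_row_free => a; rewrite TE => /mu_min a0.
  by rewrite -[a]rVpolyK a0 ?linear0 // size_mu ltnS size_poly.
have rT : \rank T = m.+1 by apply/eqP.
have := rank_leq_col T; rewrite rT leq_eqVlt => /predU1P[m_n | lt_m_n].
  by right=> p le_p; apply: mu_min; rewrite size_mu m_n ltnS.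
left.
(* [f] reads off the coefficient of degree [m] of [p] from [v *m p(A)]; the
   vectors whose whole [A]-orbit it kills form a stable complement of [T]. *)
pose f : 'cV_n.+1 := pinvmx T *m delta_mx ord_max 0.
have fE (p : {poly K}) : (size p <= m.+1)%N -> (v *m horner_mx A p *m f) 0 0 = p`_m.
  move=> le_p; rewrite -[p in LHS](poly_rV_K le_p) -TE /f mulmxA -(mulmxA _ T) mulmxVp //.
  by rewrite mulmx1 -colE mxE mxE.
(* Powers of A beyond m reduce modulo mu, so m + 1 columns test the whole orbit. *)
pose H : 'M_(n.+1, m.+1) := \matrix_(i, j) (A ^+ j *m f) i 0.
have HE (w : 'rV_n.+1) j : (w *m H) 0 j = (w *m A ^+ j *m f) 0 0.
  by rewrite -mulmxA !mxE; apply: eq_bigr => i _; rewrite mxE.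
have kerH (w : 'rV_n.+1) p : w *m H = 0 -> w *m horner_mx A p *m f = 0.
  move=> wH; rewrite -(horner_mx_modp p muA) -(poly_rV_K (size_mod p)).
  rewrite /rVpoly poly_def raddf_sum mulmx_sumr mulmx_suml big1 // => i _.
  rewrite /= horner_mxZ rmorphXn /= horner_mx_X -scalemxAr -scalemxAl.
  apply/eqP; rewrite scaler_eq0; apply/orP; right; apply/eqP/rowP=> k.
  by rewrite ord1 -HE wH !mxE.
have UW0 : (T :&: kermx H = 0)%MS.
  apply/eqP/rowV0P=> w; rewrite sub_capmx => /andP[/submxP[a ->] /sub_kermxP].
  rewrite TE; set g := rVpoly a => gH.
  suffices -> : g = 0 by rewrite rmorph0 mulmx0.
  (* If g has degree s, multiplying by X^(m - s) moves its leading coefficient to degree m, where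
     [f] reads it as 0. *)
  apply/eqP; rewrite -size_poly_eq0; case E: (size g) => [//|s].
  have le_s : (s <= m)%N by rewrite -ltnS -E size_poly.
  have := kerH _ ('X^(m - s)) gH; rewrite -(mulmxA v) mulmxE -rmorphM /= => /matrixP/(_ 0 0).
  rewrite fE ?mxE; last first.
    rewrite (leq_trans (size_polyMleq _ _)) // E size_polyXn addnS /= addSn.
    by rewrite ltnS subnKC.
  rewrite coefMXn ltnNge leq_subr /= subKn // => /eqP.
  rewrite -[s]/(s.+1.-1) -E -lead_coefE lead_coef_eq0 => /eqP g0.
  by move: E; rewrite g0 size_poly0.
(* The number of columns of [H] bounds the rank of the kernel from below, the trivial intersection
   from above. *)
have rW : (\rank (kermx H) = n.+1 - m.+1)%N.
  apply/eqP; rewrite eqn_leq; apply/andP; split; last first.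
    by rewrite mxrank_ker leq_sub2l // rank_leq_col.
  rewrite leq_subRL ?(ltnW lt_m_n) // -{1}rT -mxrank_disjoint_sum //.
  exact: rank_leq_col.
exists <<T>>%MS, (kermx H); split.
- rewrite (eqmxMr A (genmxE T)) genmxE; apply/row_subP=> i.
  rewrite row_mul rowE TE -mulmxA -{2}[A]horner_mx_X mulmxE -rmorphM; exact: subT.
- apply/row_subP=> i; apply/sub_kermxP; rewrite row_mul; apply/rowP=> j.
  rewrite HE -(mulmxA _ A) mulmxE -exprS -{1}[A]horner_mx_X -rmorphXn kerH ?mxE //.
  by rewrite -row_mul mulmx_ker row0.
- by apply/eqP; rewrite -submx0 -UW0 capmxS ?genmxE.
- by rewrite genmxE rT rW subnKC ?(ltnW lt_m_n) // subn_gt0.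
Qed.

(** Fitting decomposition: write the characteristic polynomial of B as q X^m with q(0) nonzero. The
    kernels of q(B) and B^m are complementary and A-stable, and the second is nonzero as B is
    singular. If the first is zero, B^m = 0. *)
Lemma fitting_split n (A B : 'M[K]_n.+1) :
  comm_mx B A -> B \notin unitmx -> stably_split A \/ exists m, B ^+ m = 0.
Proof.
move=> cBA; rewrite unitmxE unitfE negbK => detB0.
have [m [q]] := multiplicity_XsubC (char_poly B) 0.
rewrite polyC0 subr0 -size_poly_eq0 size_char_poly /= => q0 charB.
have m_gt0 : (0 < m)%N.
  rewrite lt0n; apply: contra q0 => /eqP m0; move: charB; rewrite m0 mulr1 => <-.
  by rewrite rootE horner_coef0 char_poly_det (eqP detB0) mulr0.
have coqX : coprimep q ('X ^+ m).
  by apply: coprimep_expr; rewrite -['X]subr0 -polyC0 coprimep_XsubC.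
set U := kermxpoly B q; set W := kermxpoly B ('X ^+ m).
have UW0 : (U :&: W = 0)%MS by exact: mxdirect_kermxpoly.
have rUW : (\rank U + \rank W)%N = n.+1.
  rewrite -mxrank_disjoint_sum // -(kermxpolyM B coqX) -charB.
  rewrite /kermxpoly Cayley_Hamilton mxrank_ker mxrank0 subn0 //.
have W_gt0 : (0 < \rank W)%N.
  rewrite lt0n mxrank_eq0; apply: contraL detB0 => /eqP W0.
  rewrite -unitfE -unitmxE -row_free_unit -kermx_eq0 -submx0 -W0.
  apply/sub_kermxP; rewrite rmorphXn /= horner_mx_X -(prednK m_gt0) exprS -mulmxE.
  by rewrite mulmxA mulmx_ker mul0mx.
have [U0 | U_gt0] := posnP (\rank U); last first.
  by left; exists U, W; split=> //; exact: comm_mx_stable_kermxpoly.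
right; exists m; apply/eqP; rewrite -mxrank_eq0.
move: rUW; rewrite U0 add0n /W /kermxpoly rmorphXn /= horner_mx_X mxrank_ker => /eqP.
by rewrite -[X in _ == X]subn0 eqn_sub2lE ?rank_leq_row.
Qed.

Lemma nilpotent_index n (B : 'M[K]_n.+1) m :
  B ^+ m = 0 -> exists k, B ^+ k.+1 = 0 /\ B ^+ k != 0.
Proof.
elim: m => [/eqP|m IHm Bm]; first by rewrite expr0 oner_eq0.
by have [/IHm //|Bm_neq0] := eqVneq (B ^+ m) 0; exists m.
Qed.

(* The polynomial [q] plays the role of an irreducible factor of the minimal
   polynomial; whenever it fails to be one, a smaller [q] is exhibited. *)
Lemma exists_split_or_cyclic n (A : 'M[K]_n.+1) :
  stably_split A \/ exists v, cyclic_vector A v.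
Proof.
suffices main s (q : {poly K}) : (size q <= s)%N -> q != 0 -> horner_mx A q \notin unitmx ->
    stably_split A \/ exists v, cyclic_vector A v.
  apply: (main _ (char_poly A) (leqnn _)).
    by rewrite -size_poly_eq0 size_char_poly.
  by rewrite Cayley_Hamilton unitr0.
elim: s q => [|s IHs] q; first by rewrite leqn0 size_poly_eq0 => /eqP->; rewrite eqxx.
move=> le_q q_neq0 nuqA.
have comm_qA : comm_mx (horner_mx A q) A by exact: comm_horner_mx.
have [|[m0]] := fitting_split comm_qA nuqA; first by left.
case/nilpotent_index=> k [qk1 qk].
have /rowV0Pn[w] : horner_mx A q ^+ k != 0 by [].
case/submxP=> v def_w w_neq0.
(* As w is nonzero, a nonzero r with w r(A) = 0 has r(A) singular, so it can replace q in the
   induction. *)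
have IHr (r : {poly K}) : (size r < size q)%N -> w *m horner_mx A r = 0 ->
    r = 0 \/ (stably_split A \/ exists v, cyclic_vector A v).
  move=> lt_rq wr0; have [-> | r_neq0] := eqVneq r 0; first by left.
  right; apply: (IHs r) => //; first by rewrite -ltnS (leq_trans lt_rq).
  by apply: contra w_neq0 => ur; rewrite -[w](mulmxK ur) wr0 mul0mx.
pose mu := q ^+ k.+1.
have muA : horner_mx A mu = 0 by rewrite rmorphXn.
(* Factors q are extracted one by one: if g = h q^j with j <= k, then w h(A) = v g(A) q(A)^(k - j) =
   0, and since w q(A) = 0 the remainder of h modulo q also kills w. *)
have dvd_mu (g : {poly K}) : v *m horner_mx A g = 0 ->
    mu %| g \/ (stably_split A \/ exists v, cyclic_vector A v).
  move=> vg; rewrite /mu.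
  have: (k.+1 <= k.+1)%N by [].
  elim: {1 3}k.+1 => [|j IHj] lt_jk; first by left; rewrite dvd1p.
  have [/dvdpP[h def_g] | ] := IHj (ltnW lt_jk); last by right.
  case: (IHr (h %% q)); [by rewrite ltn_modp | | |by right].
    have wh : w *m horner_mx A h = 0.
      rewrite def_w -mulmxA mulmxE -rmorphXn -rmorphM /=.
      rewrite -(subnK (lt_jk : j <= k)%N) exprD -mulrA [q ^+ j * h]mulrC -def_g.
      by rewrite mulrC rmorphM -mulmxE mulmxA vg mul0mx.
    have wq : w *m horner_mx A q = 0 by rewrite def_w -mulmxA mulmxE -exprSr qk1 mulmx0.
    have -> : h %% q = h - q * (h %/ q) by rewrite {2}(divp_eq h q) mulrC addrC addKr.
    by rewrite rmorphB rmorphM /= mulmxBr wh -mulmxE mulmxA wq mul0mx subrr.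
  by move=> /modp_eq0P q_h; left; rewrite def_g exprS dvdp_mul.
pose T : 'M_((size mu).-1, n.+1) := lin1_mx (mulmx v \o horner_mx A \o rVpoly).
have TE a : a *m T = v *m horner_mx A (rVpoly a) by rewrite mul_rV_lin1.
have mu_neq0 : mu != 0 by rewrite expf_neq0.
have lt_mu (p : {poly K}) : (size p < size mu)%N = (size p <= (size mu).-1)%N.
  by rewrite [size mu]polySpred.
(* [dvd_mu] may escape to the goal for each g separately, so freeness of [T] is decided first: when
   it fails, one concrete nonzero polynomial smaller than mu kills v, and mu cannot divide it. *)
case: (boolP (row_free T)) => [T_free | ].
  have [|split_A|cyc_v] := split_or_cyclic (v := v) mu_neq0 muA; [|by left|by right; exists v].
  move=> p; rewrite lt_mu => le_p vp0.
  rewrite -(poly_rV_K le_p) (_ : poly_rV p = 0) ?linear0 //.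
  by apply/eqP; rewrite -(mulmx_free_eq0 _ T_free) TE poly_rV_K // vp0.
rewrite -kermx_eq0 => /rowV0Pn[a /sub_kermxP aT0 a_neq0].
have [|mu_a|//] := dvd_mu (rVpoly a); first by rewrite -TE.
have /dvdp_leq/(_ mu_a) : rVpoly a != 0.
  by apply: contraNneq a_neq0 => a0; rewrite -[a]rVpolyK a0 linear0.
by rewrite leqNgt lt_mu size_poly.
Qed.

(** * Fields with at most three elements *)

Lemma sum3_idempotents_of_small n (A : 'M[K]_n) :
  (forall x : K, [\/ x = 0, x = 1 | x = 1 + 1]) -> sum3_idempotents A.
Proof.
move=> K012; elim/ltn_ind: n A => -[|n] IHn A.
  by exists 0, 0, 0; split; rewrite ?thinmx0 // /idempotent_mx mulmx0.
have [|[v /sum3_cyclic]] := exists_split_or_cyclic A.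
  by apply: sum3_split => m B ltmn; exact: IHn.
apply; rewrite -[\tr A](subrK n.+1%:R) addrC.
by case: (K012 (\tr A - n.+1%:R)) => ->; rewrite ?addr0 ?addrA; constructor.
Qed.

End SumOfThree.

(** If x is neither 0 nor 1, then K = {0, 1, x}. Were 1 + 1 = 0, x + 1 would be a fourth element;
    and 1 + 1 = 1 is impossible, so 1 + 1 = x. *)
Lemma finField_le3_cases (K : finFieldType) (x : K) :
  (#|K| <= 3)%N -> [\/ x = 0, x = 1 | x = 1 + 1].
Proof.
move=> leK3; have [->|x0] := eqVneq x 0; first by constructor.
have [->|x1] := eqVneq x 1; first by constructor.
constructor 3.
have K_01x y : y \in [:: 0; 1; x].
  apply: contraLR leK3 => nKy; rewrite -ltnNge.
  have uniq4 : uniq [:: y; 0; 1; x].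
    rewrite cons_uniq nKy /= !inE !negb_or [0 == x]eq_sym x0 [1 == x]eq_sym x1.
    by rewrite eq_sym oner_eq0.
  by rewrite -[4%N]/(size [:: y; 0; 1; x]) -(card_uniqP uniq4) max_card.
have := K_01x (1 + 1); rewrite !inE => /or3P[|/eqP|/eqP-> //]; last first.
  by rewrite -[RHS]addr0 => /addrI/eqP; rewrite oner_eq0.
rewrite addr_eq0 => /eqP one_opp.
have := K_01x (x + 1); rewrite !inE => /or3P[|/eqP|/eqP].
- by rewrite addr_eq0 -one_opp (negPf x1).
- by rewrite -[RHS]add0r => /addIr/eqP; rewrite (negPf x0).
- by rewrite -[RHS]addr0 => /addrI/eqP; rewrite oner_eq0.
Qed.

Theorem proposition9 (K : finFieldType) (hK : (#|K| <= 3)%N)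
    (n : nat) (hn : (1 <= n)%N) (A : 'M[K]_n) :
  exists P Q R : 'M[K]_n,
    [/\ idempotent_mx P, idempotent_mx Q, idempotent_mx R & A = P + Q + R].
Proof. by apply: sum3_idempotents_of_small => x; exact: finField_le3_cases. Qed.
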